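(* Let $p\in\mathbb{C}[x_1,\dots,x_n]$ be a form of degree $3r$. Then $p=f_1^3+f_2^3$ for some non-proportional forms $f_1,f_2$ of degree $r$ if and only if $p$ has a factorization $p=g_1g_2g_3$ into pairwise non-proportional but linearly dependent forms $g_1,g_2,g_3$ (of degree $r$), and in this correspondence $\langle f_1,f_2\rangle=\langle g_1,g_2,g_3\rangle$. Moreover, if $p$ belongs to exactly $m$ different subspaces of the form $\langle F,G\rangle^3$ with $F,G$ non-proportional forms of degree $r$, then $N(p)\le m$; and if in addition $p$ is not divisible by the square of a form of degree $r$, then $N(p)=m$.
   Context: For non-proportional forms $F,G$, $\langle F,G\rangle=\{c_1F+c_2G:c_i\in\mathbb{C}\}$ and $\langle F,G\rangle^3=\langle F^3,F^2G,FG^2,G^3\rangle$, the set of all $h(F,G)$ with $h$ a binary cubic form. For a form $p$ of degree $3r$, $N(p)$ is the number of representations $p=f_1^3+f_2^3$ with $f_1,f_2$ non-proportional forms of degree $r$, where two representations are counted as the same if the unordered pairs $\{f_1^3,f_2^3\}$ coincide. *)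

(* Defs.v *)
From mathcomp Require Import all_boot all_order all_algebra.
From mathcomp Require Import complex mpoly.
From mathcomp Require Import boolp classical_sets functions cardinality reals.

Set Implicit Arguments.
Unset Strict Implicit.
Unset Printing Implicit Defensive.

Import GRing.Theory.
Local Open Scope ring_scope.
Local Open Scope complex_scope.
Local Open Scope classical_set_scope.

Section LinearAlgebra.
Variables (K : fieldType) (V : lmodType K).
Implicit Types (u v : V) (s : seq V).

Definition proportional u v : Prop :=
  (exists c : K, u = c *: v) \/ (exists c : K, v = c *: u).

(* Only the first [size s] values of the coefficient function [c] matter. *)
Definition lin_span s : set V :=
  [set v | exists c : nat -> K, v = \sum_(i < size s) c i *: s`_i].

Definition lin_dep s : Prop :=
  exists c : nat -> K,
    (exists2 i, (i < size s)%N & c i != 0) /\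
    \sum_(i < size s) c i *: s`_i = 0.

End LinearAlgebra.

Section Forms.
Variables (R : realType) (n : nat).
Local Notation poly := {mpoly R[i][n]}.
Implicit Types (r : nat) (p f g F G : poly).

(* The zero polynomial is homogeneous of every degree. *)
Definition form_of_deg r p : Prop := p \is r.-homog.

Definition nonprop_forms r F G : Prop :=
  [/\ form_of_deg r F, form_of_deg r G & ~ proportional F G].

Definition sum_two_cubes r p f1 f2 : Prop :=
  nonprop_forms r f1 f2 /\ p = f1 ^+ 3 + f2 ^+ 3.

Definition dep_factorization r p g1 g2 g3 : Prop :=
  [/\ [/\ nonprop_forms r g1 g2, nonprop_forms r g1 g3
        & nonprop_forms r g2 g3],
      lin_dep [:: g1; g2; g3] & p = g1 * g2 * g3].

Definition cubic_span F G : set poly :=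
  lin_span [:: F ^+ 3; F ^+ 2 * G; F * G ^+ 2; G ^+ 3].

Definition cubic_spans_containing r p : set (set poly) :=
  [set W | W p /\ exists F G, nonprop_forms r F G /\ W = cubic_span F G].

(* N(p) is the cardinal of this set; a representation is recorded as the
   unordered pair of its cubes. *)
Definition cube_reps r p : set (set poly) :=
  [set P | exists f1 f2,
     sum_two_cubes r p f1 f2 /\ P = [set f1 ^+ 3; f2 ^+ 3]].

Definition square_divisible r p : Prop :=
  exists q s : poly, form_of_deg r q /\ p = q ^+ 2 * s.

End Forms.

(* Main.v *)
(**
If w is a primitive cube root of unity, f1^3 + f2^3 is the product of f1 + f2,
f1 + w f2 and f1 + w^2 f2, which are linearly dependent; conversely
a linear change of variables turns uv(u + v) into a sum of two cubes.

For the counting, send a representation f1^3 + f2^3 to the space spanned by the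
cubics in f1 and f2.  The point is that this space W determines <f1, f2>.
Non-proportional f and g satisfy no homogeneous relation, so if W also consists
of the cubics in f and g, then F = f1 and G = f2 make F^3, F^2 G, F G^2, G^3
polynomials in f/g of degree at most 3 (up to the factor g^3), in geometric
progression and generating the unit ideal.  Hence F^3 is a constant times the
cube of a polynomial of degree at most 1 in f/g, and F lies in <f, g>.  Inside
a fixed <f1, f2> a binary cubic is a sum of two cubes in at most one way.  If p
has no square factor of degree r, a binary cubic representing p splits into
three distinct linear factors and hence is a sum of two cubes, so the map is
onto.
*)
From HB Require Import structures.
Require Import Defs.
From mathcomp Require Import all_boot all_order all_algebra.
From mathcomp Require Import complex mpoly polydiv zify ring fraction.
From mathcomp Require Import boolp classical_sets functions cardinality reals.

Local Open Scope ring_scope.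
Local Open Scope complex_scope.
Local Open Scope classical_set_scope.
Local Open Scope card_scope.

Set Implicit Arguments.
Unset Strict Implicit.
Unset Printing Implicit Defensive.
Import GRing.Theory.

(** * Spans, dependence and proportionality in a vector space *)

Section LinearSpan.
Variables (K : fieldType) (V : lmodType K).
Implicit Types (u v w x y : V) (s t : seq V).

Lemma lin_spanD s u v : lin_span s u -> lin_span s v -> lin_span s (u + v).
Proof.
move=> [a ->] [b ->]; exists (fun i => a i + b i).
by rewrite -big_split; apply: eq_bigr => i _; rewrite scalerDl.
Qed.

Lemma lin_spanZ s (a : K) u : lin_span s u -> lin_span s (a *: u).
Proof.
move=> [b ->]; exists (fun i => a * b i).
by rewrite scaler_sumr; apply: eq_bigr => i _; rewrite scalerA.
Qed.

Lemma lin_span0 s : lin_span s 0.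
Proof. by exists (fun=> 0); rewrite big1 // => i _; rewrite scale0r. Qed.

Lemma mem_lin_span s u : u \in s -> lin_span s u.
Proof.
move=> us; exists (fun i => (i == index u s)%:R).
have ltu : (index u s < size s)%N by rewrite index_mem.
rewrite (bigD1 (Ordinal ltu)) //= eqxx scale1r nth_index // big1 ?addr0 // => i.
by rewrite -val_eqE /= => /negbTE ->; rewrite scale0r.
Qed.

Lemma nth_lin_span s i : lin_span s s`_i.
Proof.
have [lti|gei] := ltnP i (size s); first exact/mem_lin_span/mem_nth.
by rewrite nth_default //; apply: lin_span0.
Qed.

Lemma sub_lin_span s t :
  (forall u, u \in s -> lin_span t u) -> lin_span s `<=` lin_span t.
Proof.
move=> st _ [c ->]; elim/big_ind: _ => [||i _]; first exact: lin_span0.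
  by move=> u v; apply: lin_spanD.
by apply/lin_spanZ/st/mem_nth.
Qed.

Lemma lin_span2P u v w :
  lin_span [:: u; v] w <-> exists a b, w = a *: u + b *: v.
Proof.
split=> [[c ->]|[a [b ->]]].
  by exists (c 0%N), (c 1%N); rewrite !big_ord_recr big_ord0 /= add0r.
by exists (nth 0 [:: a; b]); rewrite !big_ord_recr big_ord0 /= add0r.
Qed.

Lemma lin_span4P u v x y w : lin_span [:: u; v; x; y] w <->
  exists a b c d, w = a *: u + b *: v + c *: x + d *: y.
Proof.
split=> [[c ->]|[a [b [c [d ->]]]]].
  exists (c 0%N), (c 1%N), (c 2%N), (c 3%N).
  by rewrite !big_ord_recr big_ord0 /= add0r.
by exists (nth 0 [:: a; b; c; d]); rewrite !big_ord_recr big_ord0 /= add0r.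
Qed.

Lemma lin_dep3P u v w : lin_dep [:: u; v; w] <->
  exists a b c, [|| a != 0, b != 0 | c != 0] /\ a *: u + b *: v + c *: w = 0.
Proof.
split=> [[c [[i /= lti ci0]]]|[a [b [c [nz E]]]]].
  rewrite !big_ord_recr big_ord0 /= add0r => E.
  exists (c 0%N), (c 1%N), (c 2%N); split=> //.
  by case: i lti ci0 => [|[|[|]]] // _ ->; rewrite ?orbT.
exists (nth 0 [:: a; b; c]); split; last first.
  by rewrite !big_ord_recr big_ord0 /= add0r.
by case/or3P: nz => nz; [exists 0%N | exists 1%N | exists 2%N].
Qed.

Lemma not_proportionalP u v : ~ proportional u v <->
  forall a b : K, a *: u + b *: v = 0 -> a = 0 /\ b = 0.
Proof.
split=> [npr a b E|free [[c E]|[c E]]]; last 2 first.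
- have [|/eqP] := free 1 (- c); first by rewrite scale1r E scaleNr subrr.
  by rewrite oner_eq0.
- have [|_ /eqP] := free (- c) 1; first by rewrite scale1r E scaleNr addNr.
  by rewrite oner_eq0.
have [a0|a0] := eqVneq a 0; have [b0|b0] := eqVneq b 0 => //; case: npr.
- right; exists 0; apply/eqP; move/eqP: E.
  by rewrite a0 !scale0r add0r scaler_eq0 (negPf b0).
- left; exists (- (a^-1 * b)); apply: (scalerI a0).
  rewrite scalerA mulrN mulrA mulfV // mul1r scaleNr.
  by apply/eqP; rewrite -addr_eq0 E.
- left; exists (- (a^-1 * b)); apply: (scalerI a0).
  rewrite scalerA mulrN mulrA mulfV // mul1r scaleNr.
  by apply/eqP; rewrite -addr_eq0 E.
Qed.

(** Eliminating between the two coefficient equations of a relation shows that [x] and [y], each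
    times the determinant, vanish. *)
Lemma not_proportional_det u v (a b c d : K) : ~ proportional u v ->
  a * d - b * c != 0 -> ~ proportional (a *: u + b *: v) (c *: u + d *: v).
Proof.
move=> /not_proportionalP free det; apply/not_proportionalP => x y E.
have [|E1 E2] := free (x * a + y * c) (x * b + y * d).
  rewrite -E !scalerDr !scalerDl !scalerA !addrA; congr (_ + _).
  by rewrite -!addrA; congr (_ + _); rewrite addrC.
split; apply/eqP; rewrite -(mulIr_eq0 _ (mulIf det)).
  suff -> : x * (a * d - b * c) = (x * a + y * c) * d - (x * b + y * d) * c.
    by rewrite E1 E2 !mul0r subr0.
  by ring.
suff -> : y * (a * d - b * c) = (x * b + y * d) * a - (x * a + y * c) * b.
  by rewrite E1 E2 !mul0r subr0.
by ring.
Qed.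

(** The matrix expressing [x], [y] in [u], [v] is invertible, and Cramer's rule expresses [u] and
    [v] back. *)
Lemma not_proportional_span u v x y : ~ proportional x y ->
  lin_span [:: u; v] x -> lin_span [:: u; v] y ->
  ~ proportional u v /\ lin_span [:: u; v] = lin_span [:: x; y].
Proof.
move=> npr /lin_span2P [a [b Ex]] /lin_span2P [c [d Ey]].
have free := (not_proportionalP x y).1 npr.
have det : a * d - b * c != 0.
  (* With zero determinant the rows of the adjugate matrix are relations between [x] and [y].
     Freeness then gives [a = b = 0], so [x = 0], which is absurd. *)
  apply/negP => /eqP det0.
  have Edb : d *: x + (- b) *: y = 0.
    rewrite Ex Ey !scalerDr !scalerA addrACA -!scalerDl.
    rewrite (_ : d * a + _ = 0); last by rewrite -det0; ring.
    by rewrite (_ : d * b + _ = 0) ?scale0r ?addr0 //; ring.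
  have Eca : (- c) *: x + a *: y = 0.
    rewrite Ex Ey !scalerDr !scalerA addrACA -!scalerDl.
    rewrite (_ : _ * b + _ = 0); last by rewrite -det0; ring.
    by rewrite (_ : _ * a + _ = 0) ?scale0r ?addr0 //; ring.
  have [_ /eqP] := free _ _ Edb; rewrite oppr_eq0 => /eqP b0.
  have [_ a0] := free _ _ Eca.
  have [|/eqP] := free 1 0; last by rewrite oner_eq0.
  by rewrite Ex a0 b0 !scale0r !addr0 scaler0.
have Eu : u = (d / (a * d - b * c)) *: x + (- b / (a * d - b * c)) *: y.
  rewrite Ex Ey !scalerDr !scalerA addrACA -!scalerDl.
  rewrite (_ : _ / _ * a + _ = 1); last by field.
  by rewrite (_ : _ / _ * b + _ = 0) ?scale0r ?scale1r ?addr0 //; field.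
have Ev : v = (- c / (a * d - b * c)) *: x + (a / (a * d - b * c)) *: y.
  rewrite Ex Ey !scalerDr !scalerA addrACA -!scalerDl.
  rewrite (_ : _ / _ * b + _ = 1); last by field.
  by rewrite (_ : _ / _ * a + _ = 0) ?scale0r ?scale1r ?add0r //; field.
split.
  rewrite Eu Ev; apply: not_proportional_det npr _.
  rewrite (_ : _ - _ = (a * d - b * c)^-1) ?invr_neq0 //.
  by field.
rewrite eqEsubset; split; apply: sub_lin_span => w; rewrite !inE.
  by case/orP => /eqP ->; apply/lin_span2P; [rewrite Eu|rewrite Ev]; do 2!eexists.
by case/orP => /eqP ->; apply/lin_span2P; do 2!eexists; [exact: Ex|exact: Ey].
Qed.

Lemma lin_span3_dep u v w : lin_span [:: u; v] w ->
  lin_span [:: u; v; w] = lin_span [:: u; v].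
Proof.
move=> H; rewrite eqEsubset; split; apply: sub_lin_span => x.
  rewrite !inE => /or3P [] /eqP -> //; apply: mem_lin_span;
  by rewrite !inE eqxx ?orbT.
by rewrite !inE => /orP [] /eqP ->; apply: mem_lin_span; rewrite !inE eqxx ?orbT.
Qed.

End LinearSpan.

(** * Univariate polynomials in geometric progression *)

(** Let [A / B] be [q1 / q0] in lowest terms. The progression forces the four polynomials to be a
    common factor [e] times [B ^+ 3], [B ^+ 2 * A], [B * A ^+ 2] and [A ^+ 3]. The last hypothesis
    then makes [e] divide 1. *)
Lemma twisted_cubic_param (K : fieldType) (q0 q1 q2 q3 : {poly K})
    (c0 c1 c2 c3 : K) : q0 != 0 ->
    q0 * q2 = q1 ^+ 2 -> q0 * q3 = q1 * q2 ->
    c0 *: q0 + c1 *: q1 + c2 *: q2 + c3 *: q3 = 1 ->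
  exists B : {poly K}, exists2 e : K, e != 0 & q0 = e *: B ^+ 3.
Proof.
move=> q0nz E02 E03 E1.
pose c := gcdp q0 q1; pose B := q0 %/ c; pose A := q1 %/ c.
have cnz : c != 0 by rewrite gcdp_eq0 negb_and q0nz.
have Eq0 : q0 = B * c by rewrite divpK // dvdp_gcdl.
have Eq1 : q1 = A * c by rewrite divpK // dvdp_gcdr.
have Bnz : B != 0 by apply: contraNneq q0nz => B0; rewrite Eq0 B0 mul0r.
have cop : coprimep B A by rewrite coprimep_div_gcd // q0nz.
have Eq2 : B * q2 = A ^+ 2 * c.
  by apply: (mulIf cnz); rewrite mulrAC -Eq0 E02 Eq1; ring.
have Eq3 : B * q3 = A * q2.
  by apply: (mulIf cnz); rewrite mulrAC -Eq0 E03 Eq1; ring.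
(* Gauss's lemma: [B] divides [A ^+ 2 * c] and is coprime to [A ^+ 2]. The same argument with
   [A ^+ 3] extracts a further factor [B] from [d]. *)
have /dvdpP [d Ec] : B %| c.
  by rewrite -(Gauss_dvdpr _ (coprimep_expr 2 cop)) -Eq2 dvdp_mulr.
have Eq2' : q2 = A ^+ 2 * d by apply: (mulfI Bnz); rewrite Eq2 Ec; ring.
have /dvdpP [e Ed] : B %| d.
  rewrite -(Gauss_dvdpr _ (coprimep_expr 3 cop)).
  by rewrite (_ : _ * d = B * q3) ?dvdp_mulr // Eq3 Eq2'; ring.
have Eq3' : q3 = A ^+ 3 * e.
  by apply: (mulfI Bnz); rewrite Eq3 Eq2' Ed; ring.
have /size_poly1P [e0 e0nz Ee] : size e == 1.
  rewrite -dvdp1; apply/dvdpP.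
  exists (c0 *: B ^+ 3 + c1 *: (B ^+ 2 * A) + c2 *: (B * A ^+ 2) + c3 *: A ^+ 3).
  by rewrite -E1 Eq0 Eq1 Eq2' Eq3' Ec Ed -!mul_polyC; ring.
by exists B, e0 => //; rewrite Eq0 Ec Ed Ee -mul_polyC; ring.
Qed.

Lemma size_cubic (K : nzRingType) (a b c d : K) :
  (size (a *: 'X^3 + b *: 'X^2 + c *: 'X + d *: 1)%R <= 4)%N.
Proof.
apply/leq_sizeP => j j3; rewrite !coefE.
by case: j j3 => [|[|[|[|j]]]] //= _; rewrite !mulr0 !addr0.
Qed.

(** * Substituting the quotient of two non-proportional polynomials *)

Section RatioEval.
Variables (K : closedFieldType) (n : nat) (f g : {mpoly K[n]}).
Hypothesis fg : ~ proportional f g.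
Local Notation L := {fraction {mpoly K[n]}}.
Local Notation frac := (@tofrac {mpoly K[n]}).

(** Substitution of [f / g] for the variable. Up to the factor [frac g ^+ 3], it presents cubics in
    [f] and [g] as univariate polynomials, for which gcd and degree arguments are available. *)
Definition ratio_eval : {poly K} -> L :=
  horner_eval (frac f / frac g) \o map_poly (frac \o @mpolyC n K).

HB.instance Definition _ := GRing.RMorphism.on ratio_eval.

Lemma ratio_den_neq0 : frac g != 0.
Proof.
rewrite tofrac_eq0; apply/eqP => g0; apply: fg.
by right; exists 0; rewrite scale0r g0.
Qed.

Lemma ratio_evalX : ratio_eval 'X = frac f / frac g.
Proof. by rewrite /ratio_eval /= map_polyX /horner_eval hornerX. Qed.

Lemma ratio_evalZ c q : ratio_eval (c *: q) = frac c%:MP * ratio_eval q.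
Proof. by rewrite /ratio_eval /= linearZ /horner_eval /= hornerZ. Qed.

Lemma ratio_evalC c : ratio_eval c%:P = frac c%:MP.
Proof. by rewrite /ratio_eval /= map_polyC /horner_eval hornerC. Qed.

Lemma fracZ c p : frac (c *: p) = frac c%:MP * frac p.
Proof. by rewrite -mul_mpolyC rmorphM. Qed.

(** A nonzero polynomial over a closed field is a product of linear factors, and a factor with root
    [z] vanishes at [f / g] only if [f = z *: g]. *)
Lemma ratio_eval_inj : injective ratio_eval.
Proof.
apply: raddf_inj => q q0; apply/eqP; apply: contra_eqT q0 => qnz.
have [s ->] := closed_field_poly_normal q.
rewrite /= ratio_evalZ mulf_neq0 //.
  by rewrite tofrac_eq0 mpolyC_eq0 lead_coef_eq0.
rewrite rmorph_prod prodf_seq_neq0; apply/allP => z _ /=.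
rewrite rmorphB /= ratio_evalX ratio_evalC subr_eq0.
apply/eqP => E; apply: fg; left; exists z.
by apply/eqP; rewrite -tofrac_eq fracZ -E divfK ?ratio_den_neq0.
Qed.

Lemma ratio_eval_size2 (B : {poly K}) : (size B <= 2)%N ->
  frac g * ratio_eval B = frac (B`_1 *: f + B`_0 *: g).
Proof.
move=> sB; have EB : B = B`_1 *: 'X + B`_0 *: 1.
  apply/polyP => i; rewrite !coefE.
  case: i => [|[|i]]; rewrite ?mulr0 ?mulr1 ?add0r ?addr0 /= ?mulr0 ?addr0 //.
  by rewrite nth_default // (leq_trans sB).
have gnz := ratio_den_neq0.
have aux (F : fieldType) (x y a b : F) : y != 0 ->
  y * (a * (x / y) + b * 1) = a * x + b * y by move=> ?; field.
rewrite {1}EB rmorphD /= !ratio_evalZ ratio_evalX rmorph1 rmorphD /= !fracZ.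
by apply: aux.
Qed.

Lemma ratio_eval_cubic (a b c d : K) :
  frac (a *: f ^+ 3 + b *: (f ^+ 2 * g) + c *: (f * g ^+ 2) + d *: g ^+ 3) =
  frac g ^+ 3 * ratio_eval (a *: 'X^3 + b *: 'X^2 + c *: 'X + d *: 1).
Proof.
have gnz := ratio_den_neq0.
have aux (F : fieldType) (x y s t u v : F) : y != 0 ->
    s * x ^+ 3 + t * (x ^+ 2 * y) + u * (x * y ^+ 2) + v * y ^+ 3 =
    y ^+ 3 * (s * (x / y) ^+ 3 + t * (x / y) ^+ 2 + u * (x / y) + v * 1).
  by move=> ?; field.
rewrite !rmorphD /= !ratio_evalZ !rmorphXn /= !ratio_evalX rmorph1 /= !fracZ.
rewrite [frac (f ^+ 2 * g)]tofracM [frac (f * _)]tofracM !tofracXn; exact: aux.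
Qed.

End RatioEval.

(** * Freeness of the cubic monomials, and cube roots *)

(** Divided by the cube of [g], the relation says that a univariate polynomial with coefficients
    [a], [b], [c], [d] is zero at [f / g]; injectivity of the substitution makes it zero. *)
Lemma cubic_forms_free (K : closedFieldType) (n : nat) (f g : {mpoly K[n]})
    (a b c d : K) : ~ proportional f g ->
    a *: f ^+ 3 + b *: (f ^+ 2 * g) + c *: (f * g ^+ 2) + d *: g ^+ 3 = 0 ->
  [/\ a = 0, b = 0, c = 0 & d = 0].
Proof.
move=> fg /(congr1 (@tofrac _)); rewrite (ratio_eval_cubic fg) rmorph0 => /eqP.
rewrite mulf_eq0 expf_eq0 (negPf (ratio_den_neq0 fg)) andbF /= => /eqP E.
have /polyP q0 := ratio_eval_inj fg (etrans E (esym (rmorph0 _))).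
by split; [have := q0 3 | have := q0 2 | have := q0 1 | have := q0 0];
  rewrite !coefE /= ?(mulr0, mulr1, addr0, add0r).
Qed.

Lemma closed_cube_root (K : closedFieldType) (a : K) : exists z, z ^+ 3 = a.
Proof.
have [z E] := solve_monicpoly (fun i => if i == 0%N then a else 0) (isT : 0 < 3)%N.
exists z; rewrite E !big_ord_recl big_ord0 /=.
by rewrite !mul0r !addr0 mulr1.
Qed.

(** A root of the third cyclotomic polynomial, so a cube root of unity, distinct from 1 once 3 is
    nonzero. The equation is oriented as a reduction rule for [ring]. *)
Lemma closed_cube_unity (K : closedFieldType) : exists w : K, w ^+ 2 = - w - 1.
Proof.
have [z E] := solve_monicpoly (fun _ => -1 : K) (isT : 0 < 2)%N.
by exists z; rewrite E !big_ord_recl big_ord0 /=; ring.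
Qed.

(** The difference of the cubes splits into three linear factors by means of [w], and one of them
    must vanish. *)
Lemma eq_cubes_scale (K : closedFieldType) (n : nat) (f g : {mpoly K[n]}) :
  f ^+ 3 = g ^+ 3 -> exists z : K, f = z *: g.
Proof.
move=> E; have [w Ew] := closed_cube_unity K.
have Ew' : w%:MP_[n] ^+ 2 = - w%:MP - 1.
  by rewrite -rmorphXn Ew rmorphB rmorphN rmorph1.
have /eqP : (f - g) * ((f - w *: g) * (f - w ^+ 2 *: g)) = 0.
  rewrite -(subrr (g ^+ 3)) -{1}E -!mul_mpolyC rmorphXn /= Ew'; ring: Ew'.
rewrite !mulf_eq0 !subr_eq0 => /or3P [] /eqP ->;
  [exists 1 | exists w | exists (w ^+ 2)] => //.
by rewrite scale1r.
Qed.

(** * Spaces of binary cubics, and sums of two cubes inside them *)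

Section BinaryCubics.
Variables (K : closedFieldType) (n : nat).
Hypothesis nz3 : (3 : K) != 0.
Local Notation poly := {mpoly K[n]}.
Implicit Types (f g F G u v w p : poly) (a b c d : K).

(* Over [R[i]] this is convertible to [cubic_span]. *)
Definition cubics F G := lin_span [:: F ^+ 3; F ^+ 2 * G; F * G ^+ 2; G ^+ 3].

Lemma cubicsP F G w : cubics F G w <->
  exists a b c d,
    w = a *: F ^+ 3 + b *: (F ^+ 2 * G) + c *: (F * G ^+ 2) + d *: G ^+ 3.
Proof. exact: lin_span4P. Qed.

Lemma cubics_mul f g u v w :
    lin_span [:: f; g] u -> lin_span [:: f; g] v -> lin_span [:: f; g] w ->
  cubics f g (u * v * w).
Proof.
move=> /lin_span2P [a [a' ->]] /lin_span2P [b [b' ->]] /lin_span2P [c [c' ->]].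
apply/cubicsP; exists (a * b * c), (a * b * c' + a * b' * c + a' * b * c).
exists (a * b' * c' + a' * b * c' + a' * b' * c), (a' * b' * c').
by rewrite -!mul_mpolyC; ring.
Qed.

(** Each of the four generators is a product of three elements of the common plane. *)
Lemma cubics_sub f g F G : lin_span [:: F; G] = lin_span [:: f; g] ->
  cubics F G `<=` cubics f g.
Proof.
move=> E; have HF : lin_span [:: f; g] F.
  by rewrite -E; apply: mem_lin_span; rewrite inE eqxx.
have HG : lin_span [:: f; g] G.
  by rewrite -E; apply: mem_lin_span; rewrite !inE eqxx orbT.
apply: sub_lin_span => u; rewrite !inE -/(cubics f g) => /or4P [] /eqP ->.
- by rewrite (_ : F ^+ 3 = F * F * F); [apply: cubics_mul | ring].
- by rewrite expr2; apply: cubics_mul.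
- by rewrite expr2 mulrA; apply: cubics_mul.
- by rewrite (_ : G ^+ 3 = G * G * G); [apply: cubics_mul | ring].
Qed.

Lemma cubics_eq f g F G : lin_span [:: F; G] = lin_span [:: f; g] ->
  cubics F G = cubics f g.
Proof.
move=> E; rewrite eqEsubset.
by split; [exact: cubics_sub E | exact: cubics_sub (esym E)].
Qed.

Lemma cubicsC F G : cubics F G = cubics G F.
Proof.
apply: cubics_eq; rewrite eqEsubset.
by split; apply: sub_lin_span => u us; apply: mem_lin_span; move: us;
  rewrite !inE orbC.
Qed.

(* The cubes [F^3, F^2 G, F G^2, G^3] are [g^3 q_i(f/g)] for polynomials [q_i]
   in geometric progression which generate the unit ideal. *)
Lemma cubics_mem F G f g : ~ proportional F G -> ~ proportional f g ->
  cubics F G = cubics f g -> lin_span [:: f; g] F.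
Proof.
move=> FG fg E.
have gnz := ratio_den_neq0 fg.
have ev w : cubics F G w -> exists2 q : {poly K}, (size q <= 4)%N &
    tofrac w = tofrac g ^+ 3 * ratio_eval f g q.
  rewrite E => /cubicsP [a [b [c [d ->]]]].
  rewrite (ratio_eval_cubic fg); eexists; last reflexivity.
  exact: size_cubic.
have [q0 s0 E0] := ev _ (nth_lin_span _ 0 : cubics F G (F ^+ 3)).
have [q1 _ E1] := ev _ (nth_lin_span _ 1 : cubics F G (F ^+ 2 * G)).
have [q2 _ E2] := ev _ (nth_lin_span _ 2 : cubics F G (F * G ^+ 2)).
have [q3 _ E3] := ev _ (nth_lin_span _ 3 : cubics F G (G ^+ 3)).
(* The form [g ^+ 3] corresponds to the constant polynomial 1, so its coordinates supply the Bezout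
   relation between the [q_i]. *)
have /cubicsP [c0 [c1 [c2 [c3 Eg]]]] : cubics F G (g ^+ 3).
  by rewrite E; apply: (nth_lin_span _ 3).
have g3nz : tofrac g ^+ 3 != 0 by rewrite expf_neq0.
have q0nz : q0 != 0.
  apply: contraPneq FG => q00; move/eqP: E0.
  rewrite q00 rmorph0 mulr0 tofrac_eq0 expf_eq0 /= => /eqP F0.
  by apply; left; exists 0; rewrite F0 scale0r.
(* Multiplicative identities between cubics pass to the polynomials, because the substitution is
   injective. *)
have eqM (x y x' y' : poly) (q s q' s' : {poly K}) : x * y = x' * y' ->
    tofrac x = tofrac g ^+ 3 * ratio_eval f g q ->
    tofrac y = tofrac g ^+ 3 * ratio_eval f g s ->
    tofrac x' = tofrac g ^+ 3 * ratio_eval f g q' ->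
    tofrac y' = tofrac g ^+ 3 * ratio_eval f g s' -> q * s = q' * s'.
  move=> Exy Ex Ey Ex' Ey'; apply: (ratio_eval_inj fg).
  apply: (mulfI g3nz); apply: (mulfI g3nz).
  move/(congr1 (@tofrac _)): Exy; rewrite !rmorphM /= Ex Ey Ex' Ey' => Exy.
  by rewrite !mulrA; move: Exy; rewrite [LHS]mulrACA [RHS]mulrACA !mulrA.
have E02 : q0 * q2 = q1 ^+ 2.
  by rewrite expr2; apply: (eqM _ _ _ _ _ _ _ _ _ E0 E2 E1 E1); ring.
have E03 : q0 * q3 = q1 * q2.
  by apply: (eqM _ _ _ _ _ _ _ _ _ E0 E3 E1 E2); ring.
have E1q : c0 *: q0 + c1 *: q1 + c2 *: q2 + c3 *: q3 = 1.
  apply: (ratio_eval_inj fg); apply: (mulfI g3nz).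
  rewrite rmorph1 mulr1 !rmorphD /= !ratio_evalZ !mulrDr.
  rewrite ![tofrac g ^+ 3 * (_ * _)]mulrCA -E0 -E1 -E2 -E3.
  by rewrite -!fracZ -!rmorphD -Eg rmorphXn.
have [B [e enz Eq0]] := twisted_cubic_param q0nz E02 E03 E1q.
(* The degree of [q0] is at most 3 and is three times that of [B]. *)
have sB : (size B <= 2)%N.
  move: s0; rewrite Eq0 size_scale // => s0.
  have := size_exp B 3; move: s0.
  by case: (size (B ^+ 3)) => [|k]; case: (size B) => [|[|[|j]]] //=; lia.
(* This is [g] times the value of [B] at [f / g], so [F] and [H] have proportional cubes. *)
pose H := B`_1 *: f + B`_0 *: g.
have EF : F ^+ 3 = e *: H ^+ 3.
  apply/eqP; rewrite -tofrac_eq E0 Eq0 ratio_evalZ fracZ tofracXn.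
  by rewrite -(ratio_eval_size2 fg sB) rmorphXn /= mulrCA exprMn.
have [z Ez] := closed_cube_root e.
have [|t ->] := @eq_cubes_scale _ _ F (z *: H); first by rewrite EF exprZn Ez.
by apply/lin_spanZ/lin_spanZ/lin_span2P; exists B`_1, B`_0.
Qed.

Lemma cubics_inj F G f g : ~ proportional F G -> ~ proportional f g ->
  cubics F G = cubics f g -> lin_span [:: F; G] = lin_span [:: f; g].
Proof.
move=> FG fg E; have HF := cubics_mem FG fg E.
have HG : lin_span [:: f; g] G.
  apply: (@cubics_mem G F) => //; last by rewrite cubicsC.
  by move=> [[c Ec]|[c Ec]]; apply: FG; [right|left]; exists c.
by have [_ ->] := not_proportional_span FG HF HG.
Qed.

(** Write [g1 = a f1 + b f2] and [g2 = c f1 + d f2] and compare coefficients. The mixed terms vanish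
    only if this matrix is diagonal or antidiagonal, and then the cubes agree up to order. *)
Lemma sum_cubes_unique f1 f2 g1 g2 : ~ proportional f1 f2 ->
    ~ proportional g1 g2 -> cubics f1 f2 = cubics g1 g2 ->
    f1 ^+ 3 + f2 ^+ 3 = g1 ^+ 3 + g2 ^+ 3 ->
  [set f1 ^+ 3; f2 ^+ 3] = [set g1 ^+ 3; g2 ^+ 3].
Proof.
move=> f12 g12 /(cubics_inj f12 g12) E Ep.
have : lin_span [:: f1; f2] g1.
  by rewrite E; apply: mem_lin_span; rewrite !inE eqxx.
have : lin_span [:: f1; f2] g2.
  by rewrite E; apply: mem_lin_span; rewrite !inE eqxx orbT.
move=> /lin_span2P [c [d E2]] /lin_span2P [a [b E1]].
have [] := @cubic_forms_free _ _ f1 f2 (a ^+ 3 + c ^+ 3 - 1)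
  (3 * (a ^+ 2 * b + c ^+ 2 * d)) (3 * (a * b ^+ 2 + c * d ^+ 2))
  (b ^+ 3 + d ^+ 3 - 1) f12.
  move/eqP: Ep; rewrite eq_sym -subr_eq0 E1 E2 => /eqP <-.
  by rewrite -!mul_mpolyC; ring.
move/eqP; rewrite subr_eq0 => /eqP ac; move/eqP.
rewrite mulf_eq0 (negPf nz3) /= => /eqP abcd; move/eqP.
rewrite mulf_eq0 (negPf nz3) /= => /eqP abcd'.
move/eqP; rewrite subr_eq0 => /eqP bd.
(* Eliminating the squared terms between the two mixed coefficients leaves [c * d] times a
   determinant. The last factor cannot vanish, as [g1] and [g2] are not proportional. *)
have : c * d * (c * b - a * d) = 0.
  transitivity (b * (a ^+ 2 * b + c ^+ 2 * d) - a * (a * b ^+ 2 + c * d ^+ 2)).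
    by ring.
  by rewrite abcd abcd' !mulr0 subr0.
move/eqP; rewrite !mulf_eq0 subr_eq0 -orbA => /or3P [] /eqP.
- move=> c0; move: ac abcd; rewrite c0 !expr0n mul0r !addr0 => a1 /eqP.
  rewrite mulf_eq0 expf_eq0 /=; have [a0|_ /eqP b0] := eqVneq a 0.
    by move: a1; rewrite a0 expr0n /= => /esym/eqP; rewrite oner_eq0.
  move: bd; rewrite E1 E2 b0 c0 expr0n add0r !scale0r add0r addr0 => d1.
  by rewrite !exprZn a1 d1 !scale1r.
- move=> d0; move: bd abcd'; rewrite d0 !expr0n mulr0 !addr0 => b1 /eqP.
  rewrite mulf_eq0 expf_eq0 /=; have [b0|_] := eqVneq b 0.
    by move: b1; rewrite b0 expr0n /= => /esym/eqP; rewrite oner_eq0.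
  rewrite orbF => /eqP a0.
  move: ac; rewrite E1 E2 a0 d0 expr0n add0r !scale0r add0r addr0 => c1.
  by rewrite !exprZn b1 c1 !scale1r setUC.
move=> cb; have [] := (not_proportionalP g1 g2).1 g12 d (- b).
  rewrite E1 E2 -!mul_mpolyC.
  have cbM : c%:MP_[n] * b%:MP = a%:MP * d%:MP by rewrite -!rmorphM cb.
  by ring: cbM.
move=> d0 /eqP; rewrite oppr_eq0 => /eqP b0; move: bd.
by rewrite b0 d0 expr0n addr0 => /esym/eqP; rewrite oner_eq0.
Qed.

(** Each of [f1], [f2] has the cube of some [g_i], hence is a multiple of it; being independent,
    they span the same plane as [g1] and [g2]. *)
Lemma cube_span_determined f1 f2 g1 g2 : ~ proportional f1 f2 ->
    [set f1 ^+ 3; f2 ^+ 3] = [set g1 ^+ 3; g2 ^+ 3] ->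
  cubics f1 f2 = cubics g1 g2.
Proof.
move=> f12 E.
have mem f : f ^+ 3 = g1 ^+ 3 \/ f ^+ 3 = g2 ^+ 3 -> lin_span [:: g1; g2] f.
  case=> /eq_cubes_scale [z ->]; apply/lin_spanZ/mem_lin_span.
    by rewrite inE eqxx.
  by rewrite !inE eqxx orbT.
have H1 : [set g1 ^+ 3; g2 ^+ 3] (f1 ^+ 3) by rewrite -E; left.
have H2 : [set g1 ^+ 3; g2 ^+ 3] (f2 ^+ 3) by rewrite -E; right.
have [_ Eg] := not_proportional_span f12 (mem _ H1) (mem _ H2).
exact/cubics_eq/esym.
Qed.

Lemma quadratic_form_factor f g a b c : exists u v,
  [/\ lin_span [:: f; g] u, lin_span [:: f; g] v &
      a *: f ^+ 2 + b *: (f * g) + c *: g ^+ 2 = u * v].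
Proof.
have [->|anz] := eqVneq a 0.
  exists g, (b *: f + c *: g); split; last by rewrite -!mul_mpolyC; ring.
    by apply: mem_lin_span; rewrite !inE eqxx orbT.
  by apply/lin_span2P; exists b, c.
(* Here [z] is a root of the dehomogenised quadratic, so [f - z g] is a factor. *)
have [z Ez] := solve_monicpoly (fun i => - ([:: c; b]`_i / a)) (isT : 0 < 2)%N.
have Ec : c = - (a * z ^+ 2 + b * z).
  rewrite Ez !big_ord_recr big_ord0 /=; by field.
exists (1 *: f + (- z) *: g), (a *: f + (b + a * z) *: g); split.
- by apply/lin_span2P; do 2!eexists.
- by apply/lin_span2P; do 2!eexists.
by rewrite Ec -!mul_mpolyC; ring.
Qed.

Lemma cubics_factor f g p : cubics f g p -> exists u v w,
  [/\ lin_span [:: f; g] u, lin_span [:: f; g] v, lin_span [:: f; g] w &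
      p = u * v * w].
Proof.
move=> /cubicsP [a [b [c [d ->]]]].
have [->|anz] := eqVneq a 0.
  have [u [v [Hu Hv E]]] := quadratic_form_factor f g b c d.
  exists u, v, g; split=> //.
    by apply: mem_lin_span; rewrite !inE eqxx orbT.
  by rewrite -E -!mul_mpolyC; ring.
have [z Ez] :=
  solve_monicpoly (fun i => - ([:: d; c; b]`_i / a)) (isT : 0 < 3)%N.
have Ed : d = - (a * z ^+ 3 + b * z ^+ 2 + c * z).
  rewrite Ez !big_ord_recr big_ord0 /=; by field.
(* The quadratic has the coefficients of the quotient by the root [z], given by Horner's scheme. *)
have [u [v [Hu Hv E]]] :=
  quadratic_form_factor f g a (b + a * z) (c + (b + a * z) * z).
exists u, v, (1 *: f + (- z) *: g); split=> //.
  by apply/lin_span2P; do 2!eexists.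
by rewrite -E Ed -!mul_mpolyC; ring.
Qed.

Lemma cubes_factor f1 f2 : ~ proportional f1 f2 -> exists g1 g2 g3,
  [/\ [/\ ~ proportional g1 g2, ~ proportional g1 g3 & ~ proportional g2 g3],
      lin_dep [:: g1; g2; g3], f1 ^+ 3 + f2 ^+ 3 = g1 * g2 * g3 &
      lin_span [:: f1; f2] = lin_span [:: g1; g2; g3]].
Proof.
move=> f12; have [w Ew] := closed_cube_unity K.
(* The differences of 1, [w] and [w ^+ 2] are, up to sign, [w - 1], [w + 2] and [w * (w - 1)]; all
   are nonzero because 3 is. *)
have nz : (w - 1) * (w + 2) != 0.
  rewrite (_ : _ * _ = -3); first by rewrite oppr_eq0.
  by ring: Ew.
have wnz : w != 0.
  apply/eqP => w0; move/eqP: Ew.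
  by rewrite w0 expr0n /= oppr0 sub0r eq_sym oppr_eq0 oner_eq0.
move: nz; rewrite mulf_eq0 negb_or => /andP [w1 w2].
pose L (x : K) := 1 *: f1 + x *: f2.
have LP x : lin_span [:: f1; f2] (L x) by apply/lin_span2P; exists 1, x.
have Lnp x y : y - x != 0 -> ~ proportional (L x) (L y).
  by move=> xy; apply: not_proportional_det; rewrite // mul1r mulr1.
have np12 : ~ proportional (L 1) (L w) by apply: Lnp.
have [_ E12] := not_proportional_span np12 (LP _) (LP _).
exists (L 1), (L w), (L (w ^+ 2)); split; last by rewrite lin_span3_dep -E12.
- split=> //; apply: Lnp; rewrite Ew.
    by rewrite (_ : _ - _ = - (w + 2)) ?oppr_eq0 //; ring.
  rewrite (_ : _ - _ = w * (w - 1)) ?mulf_neq0 //.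
  by rewrite mulrBr -expr2 Ew; ring.
(* With these weights the coefficient sums are [1 + w + w ^+ 2] and [1 + w ^+ 2 + w ^+ 4], both
   zero. *)
- apply/lin_dep3P; exists 1, w, (w ^+ 2); split; first by rewrite oner_eq0.
  rewrite /L -!mul_mpolyC.
  have EwM : w%:MP_[n] ^+ 2 = - w%:MP - 1.
    by rewrite -rmorphXn Ew rmorphB rmorphN rmorph1.
  by ring: EwM.
rewrite /L -!mul_mpolyC.
have EwM : w%:MP_[n] ^+ 2 = - w%:MP - 1.
  by rewrite -rmorphXn Ew rmorphB rmorphN rmorph1.
by ring: EwM.
Qed.

Lemma dep_product_cubes g1 g2 g3 :
    ~ proportional g1 g2 -> ~ proportional g1 g3 -> ~ proportional g2 g3 ->
    lin_dep [:: g1; g2; g3] -> exists f1 f2,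
  [/\ ~ proportional f1 f2, g1 * g2 * g3 = f1 ^+ 3 + f2 ^+ 3,
      lin_span [:: f1; f2] = lin_span [:: g1; g2] &
      lin_span [:: g1; g2; g3] = lin_span [:: g1; g2]].
Proof.
move=> np12 np13 np23 /lin_dep3P [a [b [c [nz E]]]].
(* A zero coefficient would leave a relation between two of the forms, and so kill the other two
   coefficients. *)
have [anz bnz cnz] : [/\ a != 0, b != 0 & c != 0].
  split; apply: contraTneq nz => z0; move: E; rewrite z0 scale0r ?addr0 ?add0r.
  - by case/((not_proportionalP _ _).1 np23) => -> ->; rewrite eqxx.
  - by case/((not_proportionalP _ _).1 np13) => -> ->; rewrite eqxx.
  - by case/((not_proportionalP _ _).1 np12) => -> ->; rewrite eqxx.
have H3 : lin_span [:: g1; g2] g3.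
  apply/lin_span2P; exists (- a / c), (- b / c); apply: (scalerI cnz).
  rewrite scalerDr !scalerA ![c * (_ / _)]mulrC !divfK // !scaleNr.
  by apply/eqP; rewrite -opprD -addr_eq0 addrC E.
have [w Ew] := closed_cube_unity K.
have nz27 : 27 * (a * b * c) != 0.
  by rewrite (_ : 27 = 3 * (3 * 3)) ?mulf_neq0 //; ring.
have [t Et] := closed_cube_root (27 * (a * b * c))^-1.
have tnz : t != 0 by rewrite -(expf_eq0 t 3 : _ = (t == 0)) Et invr_eq0.
(* The coefficients solve [f1 + f2 = 3 t a g1], [f1 + w f2 = 3 t w^2 b g2] and
   [f1 + w^2 f2 = 3 t w c g3]. The product of the three is [27 t^3 a b c g1 g2 g3], which the choice
   of [t] normalises. *)
pose f1 := (t * (1 - w) * a) *: g1 + (t * (w ^+ 2 - w) * b) *: g2.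
pose f2 := (t * (1 - w ^+ 2) * a) *: g1 + (t * (w - w ^+ 2) * b) *: g2.
have H1 : lin_span [:: g1; g2] f1 by apply/lin_span2P; do 2!eexists.
have H2 : lin_span [:: g1; g2] f2 by apply/lin_span2P; do 2!eexists.
have np : ~ proportional f1 f2.
  apply: not_proportional_det => //.
  (* The square is the discriminant -3 of the equation of [w]; [2 * w + 1] is a factor of the
     determinant. *)
  have nzw : (2 * w + 1) ^+ 2 != 0.
    rewrite (_ : _ ^+ 2 = -3); first by rewrite oppr_eq0.
    by ring: Ew.
  rewrite (_ : _ - _ = t ^+ 2 * a * b * (3 * (2 * w + 1))).
    rewrite !mulf_neq0 //.
    by move: nzw; rewrite expf_eq0.
  by ring: Ew.
have [_ Espan] := not_proportional_span np H1 H2.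
exists f1, f2; split=> //; last exact: lin_span3_dep.
rewrite /f1 /f2; move: E; rewrite -!mul_mpolyC => E.
have EwM : w%:MP_[n] ^+ 2 = - w%:MP - 1.
  by rewrite -rmorphXn Ew rmorphB rmorphN rmorph1.
have EtK : 27 * t ^+ 3 * a * b * c = 1.
  by transitivity (t ^+ 3 * (27 * (a * b * c))); [ring | rewrite Et mulVf].
have EtM : 27 * t%:MP_[n] ^+ 3 * a%:MP * b%:MP * c%:MP = 1.
  by rewrite -(rmorph_nat (@mpolyC n K)) -rmorphXn -!rmorphM EtK rmorph1.
transitivity (27 * t%:MP_[n] ^+ 3 * a%:MP * b%:MP * g1 * g2 * (c%:MP * g3)).
  transitivity (27 * t%:MP_[n] ^+ 3 * a%:MP * b%:MP * c%:MP * (g1 * g2 * g3)).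
    by rewrite EtM mul1r.
  by ring.
have -> : c%:MP * g3 = - (a%:MP * g1) - b%:MP * g2.
  by apply/eqP; rewrite -subr_eq0 -E; apply/eqP; ring.
by ring: EwM.
Qed.

End BinaryCubics.

(** * Complex forms of fixed degree *)

Section Forms.
Variables (R : realType) (n : nat).
Local Notation C := R[i].
Local Notation poly := {mpoly C[n]}.
Implicit Types (r : nat) (p f g F G u v w : poly).

Lemma natr_neq0 k : k.+1%:R != 0 :> C.
Proof. by rewrite Num.Theory.pnatr_eq0. Qed.

Lemma form_span r f g u : form_of_deg r f -> form_of_deg r g ->
  lin_span [:: f; g] u -> form_of_deg r u.
Proof. by move=> hf hg /lin_span2P [a [b ->]]; apply: rpredD; apply: rpredZ. Qed.

Lemma nonprop_span r f g u v : nonprop_forms r f g -> ~ proportional u v ->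
  lin_span [:: f; g] u -> lin_span [:: f; g] v -> nonprop_forms r u v.
Proof. by move=> [hf hg _] uv Hu Hv; split=> //; exact: (form_span hf hg). Qed.

Lemma dep_factorization_of_cubes r p f1 f2 : sum_two_cubes r p f1 f2 ->
  exists g1 g2 g3, dep_factorization r p g1 g2 g3 /\
    lin_span [:: f1; f2] = lin_span [:: g1; g2; g3].
Proof.
move=> [f12 ->]; have [_ _ np] := f12.
have [g1 [g2 [g3 [[np12 np13 np23] dep Ep E]]]] :=
  cubes_factor (natr_neq0 2) np.
have Hg i : lin_span [:: f1; f2] [:: g1; g2; g3]`_i.
  by rewrite E; apply: nth_lin_span.
exists g1, g2, g3; split; last exact: E.
split; [split | exact: dep | exact: Ep].
- exact: nonprop_span f12 np12 (Hg 0) (Hg 1).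
- exact: nonprop_span f12 np13 (Hg 0) (Hg 2).
- exact: nonprop_span f12 np23 (Hg 1) (Hg 2).
Qed.

Lemma cubes_of_dep_factorization r p g1 g2 g3 : dep_factorization r p g1 g2 g3 ->
  exists f1 f2, sum_two_cubes r p f1 f2 /\
    lin_span [:: f1; f2] = lin_span [:: g1; g2; g3].
Proof.
move=> [[g12 g13 g23] dep ->].
have [_ _ np12] := g12; have [_ _ np13] := g13; have [_ _ np23] := g23.
have [f1 [f2 [np Ep E E3]]] :=
  dep_product_cubes (natr_neq0 2) np12 np13 np23 dep.
have Hf i : lin_span [:: g1; g2] [:: f1; f2]`_i.
  by rewrite -E; apply: nth_lin_span.
exists f1, f2; split; last by rewrite E.
split; last exact: Ep.
exact: nonprop_span g12 np (Hf 0) (Hf 1).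
Qed.

Lemma proportional_square r u v w : form_of_deg r u -> form_of_deg r v ->
  proportional u v -> square_divisible r (u * v * w).
Proof.
move=> hu hv [[c ->]|[c ->]]; [exists v, (c *: w)|exists u, (c *: w)];
  by split=> //; rewrite -!mul_mpolyC; ring.
Qed.

(** The cubic splits into three elements of the plane. A proportional pair would give a square
    factor, and three elements of a plane are dependent, so the factorization converts to two
    cubes. *)
Lemma cubes_of_cubic_span r p F G : nonprop_forms r F G -> cubic_span F G p ->
  ~ square_divisible r p ->
  exists f1 f2, sum_two_cubes r p f1 f2 /\ cubic_span f1 f2 = cubic_span F G.
Proof.
move=> FG /cubics_factor [u [v [w [Hu Hv Hw Ep]]]] sq.
have [hF hG _] := FG.
have form := form_span hF hG.
have uv : ~ proportional u v.
  by move=> pr; apply: sq; rewrite Ep; apply: proportional_square pr; apply: form.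
have uw : ~ proportional u w.
  move=> pr; apply: sq; rewrite Ep mulrAC.
  by apply: proportional_square pr; apply: form.
have vw : ~ proportional v w.
  move=> pr; apply: sq; rewrite Ep -mulrA mulrC.
  by apply: proportional_square pr; apply: form.
have [_ E] := not_proportional_span uv Hu Hv.
have Hw' : lin_span [:: u; v] w by rewrite -E.
have dep : dep_factorization r p u v w.
  split; [split | | exact: Ep].
  - exact: nonprop_span FG uv Hu Hv.
  - exact: nonprop_span FG uw Hu Hw.
  - exact: nonprop_span FG vw Hv Hw.
  case/lin_span2P: Hw' => a [b Ew]; apply/lin_dep3P; exists a, b, (-1).
  by rewrite oppr_eq0 oner_eq0 !orbT scaleN1r Ew subrr.
have [f1 [f2 [Hf Ef]]] := cubes_of_dep_factorization dep.
exists f1, f2; split; first exact: Hf.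
apply: cubics_eq; rewrite Ef E; exact: lin_span3_dep.
Qed.

End Forms.

(** * Counting representations against spaces *)

(** A choice of related elements is an injection. A relation is convenient because a set of cubes
    does not single out [f1] and [f2], and one relation serves in both directions. *)
Lemma card_le_rel (T : Type) (U : pointedType) (A : set T) (B : set U)
    (Q : T -> U -> Prop) :
    (forall x, A x -> exists2 y, B y & Q x y) ->
    (forall x x' y, A x -> A x' -> Q x y -> Q x' y -> x = x') ->
  A #<= B.
Proof.
move=> ex inj; pose h x := get [set y | B y /\ Q x y].
have hP x : A x -> B (h x) /\ Q x (h x).
  by move=> /ex [y By Qxy]; apply: (getI (P := [set y | B y /\ Q x y]) (x := y)).
apply/card_subP; exists (h @` A); last by move=> _ [x /hP [Bx _] <-].
apply: inj_card_eq => x x'; rewrite !in_setE => Ax Ax' E.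
apply: (inj _ _ (h x)) => //; first exact: (hP _ Ax).2.
by rewrite E; apply: (hP _ Ax').2.
Qed.

Theorem theorem5p1 (R : realType) (n r : nat) (p : {mpoly R[i][n]})
    (hp : form_of_deg (3 * r)%N p) :
  ((exists f1 f2, sum_two_cubes r p f1 f2) <->
   (exists g1 g2 g3, dep_factorization r p g1 g2 g3)) /\
  (forall f1 f2, sum_two_cubes r p f1 f2 ->
     exists g1 g2 g3, dep_factorization r p g1 g2 g3 /\
       lin_span [:: f1; f2] = lin_span [:: g1; g2; g3]) /\
  (forall g1 g2 g3, dep_factorization r p g1 g2 g3 ->
     exists f1 f2, sum_two_cubes r p f1 f2 /\
       lin_span [:: f1; f2] = lin_span [:: g1; g2; g3]) /\
  (forall m : nat, cubic_spans_containing r p #= `I_m ->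
     cube_reps r p #<= `I_m /\
     (~ square_divisible r p -> cube_reps r p #= `I_m)).
Proof.
split.
  split=> [[f1 [f2 /dep_factorization_of_cubes [g1 [g2 [g3 [H _]]]]]]|].
    by exists g1, g2, g3.
  move=> [g1 [g2 [g3 /cubes_of_dep_factorization [f1 [f2 [H _]]]]]].
  by exists f1, f2.
split; first exact: dep_factorization_of_cubes.
split; first exact: cubes_of_dep_factorization.
move=> m Em.
pose rel (P W : set {mpoly R[i][n]}) := exists f1 f2,
  [/\ sum_two_cubes r p f1 f2, P = [set f1 ^+ 3; f2 ^+ 3] & W = cubic_span f1 f2].
have le : cube_reps r p #<= cubic_spans_containing r p.
  apply: (@card_le_rel _ _ _ _ rel) => [P [f1 [f2 [Hf ->]]]|P P' W _ _].
    exists (cubic_span f1 f2); last by exists f1, f2.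
    have [fnp ->] := Hf; split; last by exists f1, f2.
    by apply: lin_spanD; [exact: (nth_lin_span _ 0) | exact: (nth_lin_span _ 3)].
  move=> [f1 [f2 [[[_ _ f12] Ep] -> ->]]] [g1 [g2 [[[_ _ g12] Ep'] -> E]]].
  have Epp := etrans (esym Ep) Ep'.
  exact: (sum_cubes_unique (natr_neq0 R 2) f12 g12 E Epp).
have Em' := Em; move: Em'; rewrite card_eq_le => /andP [le1 le2].
split; first exact: card_le_trans le le1.
(* Without square factors every space carries a representation, which determines the space: this is
   the reverse inequality. *)
move=> sq; apply: card_eq_trans Em; apply: Cantor_Bernstein le _.
apply: (@card_le_rel _ _ _ _ (fun W P => rel P W)).
  move=> W [Wp [F [G [FG EW]]]]; rewrite EW in Wp *.
  have [f1 [f2 [Hf <-]]] := cubes_of_cubic_span FG Wp sq.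
  exists [set f1 ^+ 3; f2 ^+ 3]; exists f1, f2.
    by split; [exact: Hf | reflexivity].
  by split; [exact: Hf | reflexivity | reflexivity].
move=> W W' P _ _ [f1 [f2 [[[_ _ f12] _] -> ->]]] [g1 [g2 [_ E ->]]].
exact: cube_span_determined f12 E.
Qed.
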